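(* Let $\mathbb F$ be an algebraically closed field of characteristic other than two. (a) Let $a\mapsto\bar a$ be any involution on $\mathbb F$ (possibly the identity). Let $\varepsilon_1,\varepsilon_2\in\mathbb F$ be nonzero and let $\varepsilon_3\in\mathbb F$ be arbitrary. Then for any pairs $(A,B)$ and $(C,D)$ of $n\times n$ matrices over $\mathbb F$, the pairs $(A,B)$ and $(C,D)$ are similar if and only if the triples ${\cal T}_{\varepsilon}(A,B)$ and ${\cal T}_{\varepsilon}(C,D)$ are *congruent. (b) The following classification problems are wild: (i) the problem of classifying triples of Hermitian forms over $\mathbb F$ with respect to a nonidentity involution on $\mathbb F$ (equivalently, of classifying triples of Hermitian matrices up to *congruence); (ii) for each $\varepsilon_1,\varepsilon_2,\varepsilon_3\in\{1,-1\}$, the problem of classifying triples of bilinear forms $({\cal A}_1,{\cal A}_2,{\cal A}_3)$ over $\mathbb F$ in which ${\cal A}_i$ is symmetric if $\varepsilon_i=1$ and skew-symmetric if $\varepsilon_i=-1$ (equivalently, of classifying the corresponding triples of symmetric or skew-symmetric matrices up to congruence).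
   Context: An involution on $\mathbb F$ is a bijection $a\mapsto\bar a$ of $\mathbb F$ onto itself with $\overline{a+b}=\bar a+\bar b$, $\overline{ab}=\bar a\bar b$, $\bar{\bar a}=a$; the identity is allowed. For a matrix $A=[a_{ij}]$, $A^*:=\bar A^T=[\bar a_{ji}]$. A matrix $A$ is Hermitian if $A^*=A$. All matrices in a tuple have the same size. Two $t$-tuples of $n\times n$ matrices $(A_1,\dots,A_t)$ and $(B_1,\dots,B_t)$ are *congruent if there is a nonsingular $S$ with $S^*A_iS=B_i$ for all $i$; when the involution is the identity this is called congruence ($S^TA_iS=B_i$). Pairs $(A,B)$ and $(C,D)$ of $n\times n$ matrices are similar if there is a nonsingular $S$ with $S^{-1}AS=C$ and $S^{-1}BS=D$. $I_n$ is the $n\times n$ identity matrix and $0_n$ the $n\times n$ zero matrix. For $n\times n$ matrices $A,B$, \[ {\cal T}_{\varepsilon}(A,B)=\left( \begin{bmatrix}0_{4n}&I_{4n}\\ \varepsilon_1 I_{4n}&0_{4n}\end{bmatrix},\ \begin{bmatrix}0_{4n}&J_{4}(0_n)\\ \varepsilon_2 J_{4}(0_n)^T&0_{4n}\end{bmatrix},\ \begin{bmatrix}0_{4n}&D(A,B)\\ \varepsilon_3 D(A^*,B^* )&0_{4n}\end{bmatrix}\right), \] where \[ J_{4}(0_n)=\begin{bmatrix}0_n&I_n&0&0\\0&0_n&I_n&0\\0&0&0_n&I_n\\0&0&0&0_n\end{bmatrix},\qquad D(X,Y)=\begin{bmatrix}I_n&0&0&0\\0&X&0&0\\0&0&Y&0\\0&0&0&0_n\end{bmatrix}.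 \] A classification problem is called wild if it contains the problem of classifying pairs of $n\times n$ matrices over $\mathbb F$ (all $n$) up to similarity. For a problem of classifying matrix triples this means: there is a fixed triple ${\cal T}(x,y)$ of $m\times m$ matrices whose entries are noncommutative polynomials over $\mathbb F$ in $x,y,x^*,y^*$ such that, for every $n\ge 1$ and every pair $(A,B)$ of $n\times n$ matrices, the triple ${\cal T}(A,B)$ of $mn\times mn$ matrices obtained by substituting $A,B,A^*,B^*$ for $x,y,x^*,y^*$ (each scalar constant $c$ being replaced by $cI_n$) belongs to the class of triples being classified, and for all pairs of $n\times n$ matrices, $(A,B)$ and $(C,D)$ are similar if and only if ${\cal T}(A,B)$ and ${\cal T}(C,D)$ are equivalent in the sense of the classification problem (here, *congruent, respectively congruent). *)

(* Defs.v *)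
From HB Require Import structures.
From mathcomp Require Import all_boot all_order all_algebra.
From mathcomp Require Import finmap.
From mathcomp Require Export sesquilinear.
From mathcomp.multinomials Require Export monalg.

Set Implicit Arguments.
Unset Strict Implicit.
Unset Printing Implicit Defensive.

Import GRing.Theory.
Local Open Scope ring_scope.

Definition starmx (F : fieldType) (conj : F -> F) (m n : nat)
    (A : 'M[F]_(m, n)) : 'M[F]_(n, m) :=
  map_mx conj A^T.

(* With conj := idfun this is ordinary congruence S^T A_i S = B_i. *)
Definition star_congruent (F : fieldType) (conj : F -> F) (t n : nat)
    (A B : t.-tuple 'M[F]_n) : Prop :=
  exists2 S : 'M[F]_n, S \in unitmx
    & forall i : 'I_t, starmx conj S *m tnth A i *m S = tnth B i.

Definition similar_pairs (F : fieldType) (n : nat) (A B C D : 'M[F]_n) : Prop :=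
  exists2 S : 'M[F]_n, S \in unitmx
    & invmx S *m A *m S = C /\ invmx S *m B *m S = D.

(* The size 4n is written \sum_(i < 4) n, the type that block matrices with
   constant block size n have in the library. *)
Definition J4 (F : fieldType) (n : nat) : 'M[F]_(\sum_(i < 4) n) :=
  \mxblock_(i < 4, j < 4)
     (if j == i.+1 :> nat then 1%:M else 0 : 'M[F]_n).

Definition D4 (F : fieldType) (n : nat) (X Y : 'M[F]_n) :
    'M[F]_(\sum_(i < 4) n) :=
  \mxdiag_(i < 4) ([:: 1%:M; X; Y; 0] : seq 'M[F]_n)`_i.

Definition Teps (F : fieldType) (conj : F -> F) (eps1 eps2 eps3 : F) (n : nat)
    (A B : 'M[F]_n) : 3.-tuple 'M[F]_(\sum_(i < 4) n + \sum_(i < 4) n) :=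
  [tuple block_mx 0 1%:M (eps1 *: 1%:M) 0;
         block_mx 0 (J4 F n) (eps2 *: (J4 F n)^T) 0;
         block_mx 0 (D4 A B) (eps3 *: D4 (starmx conj A) (starmx conj B)) 0].

(* The free associative algebra over F on four letters, standing in this order
   for x, y, x^*, y^*: the monoid algebra of the free monoid of words. *)
Definition ncpoly (F : fieldType) := {malg F[{fmonom 'I_4}]}.

(* The empty word evaluates to the identity, so a constant c becomes c I_n. *)
Definition nceval (F : fieldType) (conj : F -> F) (n : nat) (A B : 'M[F]_n)
    (p : ncpoly F) : 'M[F]_n :=
  \sum_(w <- msupp p)
     p@_w *: \prod_(l <- w) tnth [tuple A; B; starmx conj A; starmx conj B] l.

(* The (i, j) block of size n of the result is the value of the entry T i j;
   \sum_(i < m) n is the size mn. *)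
Definition ncsubst (F : fieldType) (conj : F -> F) (m n : nat) (A B : 'M[F]_n)
    (T : 'M[ncpoly F]_m) : 'M[F]_(\sum_(i < m) n) :=
  \mxblock_(i < m, j < m) nceval conj A B (T i j).

(* Wildness of the problem of classifying, up to the relation equiv, the
   triples of square matrices of arbitrary size that belong to class. *)
Definition wild_triples (F : fieldType) (conj : F -> F)
    (class : forall n : nat, 3.-tuple 'M[F]_n -> Prop)
    (equiv : forall n : nat, 3.-tuple 'M[F]_n -> 3.-tuple 'M[F]_n -> Prop) :
    Prop :=
  exists (m : nat) (T : 3.-tuple 'M[ncpoly F]_m),
    forall n : nat, (0 < n)%N ->
      let TT (A B : 'M[F]_n) := map_tuple (ncsubst conj A B) T in
      (forall A B : 'M[F]_n, class _ (TT A B)) /\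
      (forall A B C D : 'M[F]_n,
         similar_pairs A B C D <-> equiv _ (TT A B) (TT C D)).

Definition hermitian_triple (F : fieldType) (conj : F -> F) (n : nat)
    (A : 3.-tuple 'M[F]_n) : Prop :=
  forall i : 'I_3, starmx conj (tnth A i) = tnth A i.

Definition signed_symmetric_triple (F : fieldType) (eps : 3.-tuple F) (n : nat)
    (A : 3.-tuple 'M[F]_n) : Prop :=
  forall i : 'I_3,
    (tnth eps i = 1 -> tnth A i \is symmetricmx) /\
    (tnth eps i = -1 -> tnth A i \is skewmx).

(* Main.v *)
Require Import Defs.
From HB Require Import structures.
From mathcomp Require Import all_boot all_order all_algebra.
From mathcomp Require Import finmap.

Set Implicit Arguments.
Unset Strict Implicit.
Unset Printing Implicit Defensive.

Import GRing.Theory.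
Local Open Scope ring_scope.

(** Each matrix of the triple has the shape [0, X; eps X^*, 0] ([offdiag]).  A
    block diagonal S = diag(P, Q) acts on such a matrix through X |-> P^* X Q,
    so if S0 conjugates (A, B) into (C, D), then Q = diag(S0, S0, S0, S0) and
    P^* = Q^-1 carry the first triple to the second
    ([Teps_star_congruent]).

    The converse uses the first matrix M1 to trade *congruence for similarity.
    If S^* M_i S = M_i' and M1 = M1', then M1^-1 M_i S = S M1^-1 M_i', and
      M1^-1 M2 = diag(c J^T, J),   M1^-1 M3 = diag(e D(A', B'), D(A, B))
    with c = eps2 / eps1 nonzero, e = eps3 / eps1, A' = A^* and B' = B^*.  Let Q
    and U be the upper and lower right quarters of S, cut into n x n blocks.
    Since U commutes with the shift J, it is block upper triangular Toeplitz, so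
    the relation
    D(A, B) U = U D(C, D) read on the diagonal says that its diagonal block
    U_00 intertwines (A, B) and (C, D).  It remains to see that U_00 is
    invertible.  The first block column of U is U_00 followed by zeros.  In the
    first block column of Q all but the bottom block vanish by
    c J^T Q = Q J, and the bottom block vanishes because D has the identity in
    its first corner and zero in its last one.  Hence U_00 is the only nonzero
    block in the block column of S where Q and U begin, and S being invertible,
    so is U_00 ([similar_of_intertwining]).

    For wildness, the triple with signs eps_i such that conj eps_i * eps_i = 1
    satisfies M_i^* = conj eps_i M_i, hence lies in the required class; it is
    the value at (A, B) of an 8 x 8 triple of noncommutative polynomials
    ([ncsubst_polyTeps]), up to identifying 8n with 4n + 4n. *)

(** * Triples *)

Lemma ord3_ind (P : 'I_3 -> Prop) :
  P 0 -> P 1 -> P ord_max -> forall i, P i.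
Proof.
move=> P0 P1 P2 [[|[|[|//]]] ?];
  [move: P0 | move: P1 | move: P2]; by congr P; apply: val_inj.
Qed.

Lemma tnth3 (T : Type) (a b c : T) :
  (tnth [tuple a; b; c] 0 = a) * (tnth [tuple a; b; c] 1 = b) *
  (tnth [tuple a; b; c] ord_max = c).
Proof. by rewrite !(tnth_nth a). Qed.

Lemma map_tuple3 (T1 T2 : Type) (f : T1 -> T2) (a b c : T1) :
  map_tuple f [tuple a; b; c] = [tuple f a; f b; f c].
Proof. exact: val_inj. Qed.

Lemma tuple3_eq (T : Type) (a b c a' b' c' : T) :
  a = a' -> b = b' -> c = c' -> [tuple a; b; c] = [tuple a'; b'; c'].
Proof. by move=> -> -> ->. Qed.

Lemma star_congruent3 (F : fieldType) (conj : F -> F) n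
    (X Y Z X' Y' Z' : 'M[F]_n) :
  star_congruent conj [tuple X; Y; Z] [tuple X'; Y'; Z'] <->
  exists2 S, S \in unitmx &
    [/\ starmx conj S *m X *m S = X', starmx conj S *m Y *m S = Y'
      & starmx conj S *m Z *m S = Z'].
Proof.
split=> [[S Su ST] | [S Su [SX SY SZ]]]; exists S => //.
  by have := ST ord_max; have := ST 1; have := ST 0; rewrite !tnth3.
by apply: ord3_ind; rewrite !tnth3.
Qed.

(** * Conjugate transposes *)

Lemma starmxM (F : fieldType) (conj : {rmorphism F -> F}) m n p
    (A : 'M[F]_(m, n)) (B : 'M[F]_(n, p)) :
  starmx conj (A *m B) = starmx conj B *m starmx conj A.
Proof. by rewrite /starmx trmx_mul map_mxM. Qed.

Lemma starmxK (F : fieldType) (conj : involutive_rmorphism F) m n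
    (A : 'M[F]_(m, n)) :
  starmx conj (starmx conj A) = A.
Proof. by apply/matrixP=> i j; rewrite !mxE rmorphK. Qed.

Lemma starmx1 (F : fieldType) (conj : {rmorphism F -> F}) n :
  starmx conj (1%:M : 'M_n) = 1%:M.
Proof. by rewrite /starmx trmx1 map_mx1. Qed.

Lemma starmx_mxblock (F : fieldType) (conj : F -> F) (k l m n : nat)
    (B : 'I_k -> 'I_l -> 'M[F]_(m, n)) :
  starmx conj (\mxblock_(i, j) B i j) = \mxblock_(i, j) starmx conj (B j i).
Proof. by rewrite /starmx tr_mxblock; apply/matrixP=> i j; rewrite !mxE. Qed.

(** * Blocks of equal size *)

Section Blocks.
Variables (F : fieldType) (m n : nat).
Local Notation sz := (\sum_(i < m) n)%N.
Implicit Types (A B : 'M[F]_sz) (i j : 'I_m).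

Definition blk A i j : 'M[F]_n :=
  @submxblock F m m (fun=> n) (fun=> n) A i j.

Lemma blkP A B : (forall i j, blk A i j = blk B i j) -> A = B.
Proof. by move=> e; apply/mxblockP. Qed.

Lemma blk_mxblock (B : 'I_m -> 'I_m -> 'M[F]_n) i j :
  blk (\mxblock_(i, j) B i j) i j = B i j.
Proof. exact: mxblockK. Qed.

Lemma blkD A B i j : blk (A + B) i j = blk A i j + blk B i j.
Proof. exact: submxblockD. Qed.

Lemma blkZ a A i j : blk (a *: A) i j = a *: blk A i j.
Proof. by apply/matrixP=> x y; rewrite !mxE. Qed.

Lemma blkM A B i j : blk (A *m B) i j = \sum_k blk A i k *m blk B k j.
Proof.
rewrite -{1}[A]submxblockK -{1}[B]submxblockK mul_mxblock; exact: mxblockK.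
Qed.

Lemma blk1 i j : blk 1%:M i j = if i == j then 1%:M else 0.
Proof.
apply/matrixP=> x y; rewrite !mxE -val_eqE tagnat.eq_Rank.
by case: (i == j); rewrite ?mxE.
Qed.

Lemma blk_tr A i j : blk A^T i j = (blk A j i)^T.
Proof. by apply/matrixP=> x y; rewrite !mxE. Qed.

Lemma blk_diag (d : 'I_m -> 'M[F]_n) i j :
  blk (\mxdiag_i d i) i j = if i == j then d i else 0.
Proof. by rewrite blk_mxblock conform_mx_id. Qed.

Lemma blk_diagM (d : 'I_m -> 'M[F]_n) A i j :
  blk (\mxdiag_i d i *m A) i j = d i *m blk A i j.
Proof.
rewrite blkM (bigD1 i) //= blk_diag eqxx big1 ?addr0 // => k ki.
by rewrite blk_diag eq_sym (negPf ki) mul0mx.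
Qed.

Lemma blk_Mdiag (d : 'I_m -> 'M[F]_n) A i j :
  blk (A *m \mxdiag_i d i) i j = blk A i j *m d j.
Proof.
rewrite blkM (bigD1 j) //= blk_diag eqxx big1 ?addr0 // => k kj.
by rewrite blk_diag (negPf kj) mulmx0.
Qed.

End Blocks.

(** * The nilpotent shift and the diagonal matrix D *)

Section Shift.
Variables (F : fieldType) (n : nat).
Local Notation M4 := 'M[F]_(\sum_(i < 4) n).
Local Notation J := (J4 F n).
Implicit Types (U : M4) (i j k : 'I_4).

Lemma blk_J4 i j : blk J i j = if j == i.+1 :> nat then 1%:M else 0.
Proof. exact: blk_mxblock. Qed.

Lemma blk_J4M U i j k : k = i.+1 :> nat -> blk (J *m U) i j = blk U k j.
Proof.
move=> ki; rewrite blkM (bigD1 k) //= blk_J4 ki eqxx mul1mx big1 ?addr0 // => l.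
by rewrite -val_eqE /= ki blk_J4 => /negPf->; rewrite mul0mx.
Qed.

Lemma blk_MJ4 U i j k : j = k.+1 :> nat -> blk (U *m J) i j = blk U i k.
Proof.
move=> jk; rewrite blkM (bigD1 k) //= blk_J4 jk eqxx mulmx1 big1 ?addr0 // => l.
by rewrite -val_eqE blk_J4 jk eqSS eq_sym => /negPf->; rewrite mulmx0.
Qed.

Lemma blk_MJ4_col0 U i : blk (U *m J) i 0 = 0.
Proof. by rewrite blkM big1 // => k _; rewrite blk_J4 mulmx0. Qed.

Lemma blk_J4trM U i j k : i = k.+1 :> nat -> blk (J^T *m U) i j = blk U k j.
Proof.
move=> ik; rewrite -[_ *m U]trmxK trmx_mul trmxK blk_tr (blk_MJ4 _ _ ik).
by rewrite blk_tr trmxK.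
Qed.

Lemma starmx_J4 (conj : {rmorphism F -> F}) : starmx conj J = J^T.
Proof.
apply/matrixP=> x y; rewrite !mxE.
by case: ifP; rewrite !mxE ?rmorph0 ?rmorph_nat.
Qed.

Lemma starmx_D4 (conj : {rmorphism F -> F}) (X Y : 'M[F]_n) :
  starmx conj (D4 X Y) = D4 (starmx conj X) (starmx conj Y).
Proof.
apply: blkP => i j; rewrite /D4 /mxdiag starmx_mxblock !blk_mxblock eq_sym.
case: (i =P j) => [->|_]; rewrite ?conform_mx_id.
  case: j => [[|[|[|[|//]]]] ? ] //=; rewrite ?starmx1 //.
  by apply/matrixP=> x y; rewrite !mxE rmorph0.
by apply/matrixP=> x y; rewrite !mxE rmorph0.
Qed.

End Shift.

(** * Similarity from intertwining relations *)

Section Corner.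
Variables (F : fieldType) (n : nat).
Local Notation M4 := 'M[F]_(\sum_(i < 4) n).
Local Notation J := (J4 F n).

(** Q and U stand for the right quarters of the matrix S of a *congruence, and
    G, H for the lower quarters of its inverse.  The similarity is the corner
    block U_00: the relations on Q and on U clear the rest of their first block
    columns, so that the corner of G Q + H U = 1 becomes H_00 U_00 = 1. *)
Lemma similar_of_intertwining (c e : F) (A B C D A' B' : 'M[F]_n)
    (Q U G H : M4) :
  c != 0 ->
  c *: (J^T *m Q) = Q *m J -> J *m U = U *m J ->
  e *: (D4 A' B' *m Q) = Q *m D4 C D -> D4 A B *m U = U *m D4 C D ->
  G *m Q + H *m U = 1%:M ->
  similar_pairs A B C D.
Proof.
move=> c0 JQ JU DQ DU GH.
pose i1 : 'I_4 := 1; pose i2 := Ordinal (isT : (2 < 4)%N).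
pose i3 := Ordinal (isT : (3 < 4)%N).
have i4P (k : 'I_4) : [|| k == 0, k == i1, k == i2 | k == i3].
  by case: k => [[|[|[|[|//]]]] ?].
have Q0 (i k : 'I_4) : i = k.+1 :> nat -> blk Q k 0 = 0.
  move=> ik; have := congr1 (fun X => blk X i 0) JQ.
  rewrite blkZ (blk_J4trM _ _ ik) blk_MJ4_col0 => /eqP.
  by rewrite scalemx_eq0 (negPf c0) => /eqP.
(* Block (3, 0) of DQ: the last diagonal block of D is 0, the first is 1. *)
have Q30 : blk Q i3 0 = 0.
  have := congr1 (fun X => blk X i3 0) DQ.
  by rewrite blkZ blk_diagM blk_Mdiag /= mul0mx scaler0 mulmx1 => <-.
have U0 (i k : 'I_4) : k = i.+1 :> nat -> blk U k 0 = 0.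
  move=> ki; have := congr1 (fun X => blk X i 0) JU.
  by rewrite (blk_J4M _ _ ki) blk_MJ4_col0.
have U11 : blk U i1 i1 = blk U 0 0.
  have := congr1 (fun X => blk X 0 i1) JU.
  by rewrite (@blk_J4M _ _ _ _ _ i1) // (@blk_MJ4 _ _ _ _ _ 0).
have U22 : blk U i2 i2 = blk U i1 i1.
  have := congr1 (fun X => blk X i1 i2) JU.
  by rewrite (@blk_J4M _ _ _ _ _ i2) // (@blk_MJ4 _ _ _ _ _ i1).
have AU : A *m blk U 0 0 = blk U 0 0 *m C.
  have := congr1 (fun X => blk X i1 i1) DU.
  by rewrite blk_diagM blk_Mdiag /= U11.
have BU : B *m blk U 0 0 = blk U 0 0 *m D.
  have := congr1 (fun X => blk X i2 i2) DU.
  by rewrite blk_diagM blk_Mdiag /= U22 U11.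
have HU : blk H 0 0 *m blk U 0 0 = 1%:M.
  have := congr1 (fun X => blk X 0 0) GH.
  rewrite blkD !blkM blk1 eqxx big1 => [|k _]; last first.
    case/or4P: (i4P k) => /eqP->; last by rewrite Q30 mulmx0.
    - by rewrite (Q0 i1) ?mulmx0.
    - by rewrite (Q0 i2) ?mulmx0.
    - by rewrite (Q0 i3) ?mulmx0.
  rewrite add0r (bigD1 0) //= big1 ?addr0 // => k k0.
  case/or4P: (i4P k) k0 => /eqP-> // _.
  - by rewrite (U0 0) ?mulmx0.
  - by rewrite (U0 i1) ?mulmx0.
  - by rewrite (U0 i2) ?mulmx0.
have [_ Uu] := mulmx1_unit HU.
by exists (blk U 0 0) => //; rewrite -!mulmxA AU BU !mulKmx.
Qed.

End Corner.

(** * Congruence of the triples *)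

Definition offdiag (F : fieldType) (conj : F -> F) (eps : F) n (X : 'M[F]_n) :
    'M[F]_(n + n) :=
  block_mx 0 X (eps *: starmx conj X) 0.

Section StarCongruence.
Variables (F : fieldType) (conj : involutive_rmorphism F).

Lemma TepsE (eps1 eps2 eps3 : F) n (A B : 'M[F]_n) :
  Teps conj eps1 eps2 eps3 A B =
  [tuple offdiag conj eps1 1%:M; offdiag conj eps2 (J4 F n);
         offdiag conj eps3 (D4 A B)].
Proof. by rewrite /offdiag starmx1 starmx_J4 starmx_D4. Qed.

Lemma starmx_offdiag eps n (X : 'M[F]_n) : conj eps * eps = 1 ->
  starmx conj (offdiag conj eps X) = conj eps *: offdiag conj eps X.
Proof.
move=> eps1; rewrite /offdiag {1}/starmx tr_block_mx map_block_mx scale_block_mx.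
rewrite !trmx0 !map_mx0 !scaler0 scalerA eps1 scale1r -/(starmx conj X).
congr block_mx; rewrite linearZ map_mxZ; congr (_ *: _); exact: starmxK.
Qed.

Lemma offdiag_congr eps n (P Q X : 'M[F]_n) :
  starmx conj (block_mx P 0 0 Q) *m offdiag conj eps X *m block_mx P 0 0 Q =
  offdiag conj eps (starmx conj P *m X *m Q).
Proof.
rewrite {1}/starmx tr_block_mx map_block_mx !trmx0 !map_mx0.
rewrite -!/(starmx conj _) !mulmx_block !(mul0mx, mulmx0, addr0, add0r).
by rewrite /offdiag !starmxM starmxK -scalemxAr -scalemxAl mulmxA.
Qed.

(** A block diagonal matrix diag(P, Q) with P^* = Q^-1 turns a similarity of the
    upper right quarters into a *congruence: the lower left quarters, being
    multiples of conjugate transposes, follow automatically. *)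
Lemma Teps_star_congruent (eps1 eps2 eps3 : F) n (A B C D : 'M[F]_n) :
  similar_pairs A B C D ->
  star_congruent conj (Teps conj eps1 eps2 eps3 A B)
                      (Teps conj eps1 eps2 eps3 C D).
Proof.
case=> S Su [AC BD].
pose Q : 'M[F]_(\sum_(i < 4) n) := \mxdiag_i S.
pose Q' : 'M[F]_(\sum_(i < 4) n) := \mxdiag_i invmx S.
pose P := starmx conj Q'.
have Q'Q : Q' *m Q = 1%:M.
  apply: blkP=> i j; rewrite blk_diagM blk_diag blk1.
  by case: eqP => _; rewrite ?mulVmx ?mulmx0.
have [Q'u Qu] := mulmx1_unit Q'Q.
have Pu : P \in unitmx by rewrite /P /starmx map_unitmx unitmx_tr.
rewrite !TepsE; apply/star_congruent3; exists (block_mx P 0 0 Q).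
  by rewrite unitmxE det_ublock unitrM -!unitmxE Pu.
rewrite !offdiag_congr starmxK; split.
- by rewrite mulmx1 Q'Q.
- congr offdiag; apply: blkP=> i j; rewrite blk_Mdiag blk_diagM blk_J4.
  by case: eqP => _; rewrite ?mulmx1 ?mulVmx // mulmx0 mul0mx.
- congr offdiag; apply: blkP=> i j; rewrite blk_Mdiag blk_diagM !blk_diag.
  case: eqP => _; last by rewrite mulmx0 mul0mx.
  case: i => [[|[|[|[|//]]]] ?] //=; first by rewrite mulmx1 mulVmx.
  by rewrite mulmx0 mul0mx.
Qed.

(** The first matrix E of the triple is fixed by S, which lets S^* be eliminated:
    S^* = E S^-1 E^-1.  What is left are intertwining relations, whose right
    quarters meet the hypotheses of [similar_of_intertwining]. *)
Lemma similar_of_star_congruent (eps1 eps2 eps3 : F) n (A B C D : 'M[F]_n) :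
  eps1 != 0 -> eps2 != 0 ->
  star_congruent conj (Teps conj eps1 eps2 eps3 A B)
                      (Teps conj eps1 eps2 eps3 C D) ->
  similar_pairs A B C D.
Proof.
move=> e1 e2 /star_congruent3[S Su].
set X := starmx conj S; set E := block_mx 0 1%:M _ _.
set K := block_mx 0 (J4 F n) _ _; set L := block_mx 0 (D4 A B) _ _.
set L' := block_mx 0 (D4 C D) _ _ => -[XE XK XL].
pose E' : 'M[F]_(\sum_(i < 4) n + \sum_(i < 4) n) :=
  block_mx 0 (eps1^-1 *: 1%:M) 1%:M 0.
have E'E : E' *m E = 1%:M.
  rewrite mulmx_block !(mul0mx, mulmx0, addr0, add0r, mulmx1).
  by rewrite -scalemxAl mul1mx scalerA mulVf // scale1r -scalar_mx_block.
have SG : S *m (E' *m X *m E) = 1%:M.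
  by apply: mulmx1C; rewrite -!mulmxA (mulmxA X) XE.
have inter M M' : X *m M *m S = M' -> E' *m M *m S = S *m (E' *m M').
  move=> <-; rewrite -[LHS]mul1mx -SG -!mulmxA; congr (_ *m _).
  by rewrite (mulmxA E) (mulmx1C E'E) mul1mx.
have G1 : E' *m X *m E *m S = 1%:M by apply: mulmx1C.
move: G1 (inter _ _ XK) (inter _ _ XL).
move: (E' *m X *m E) => G.
(* Only the right-hand quarters of the products are needed: they involve
   the right quarters of S and the lower quarters of its left inverse G. *)
rewrite -[S]submxK -[G]submxK; set Q := ursubmx S; set U := drsubmx S.
rewrite !mulmx_block !(mul0mx, mulmx0, addr0, add0r, mul1mx).
rewrite -!scalemxAl !mul1mx scalar_mx_block => /eq_block_mx[_ _ _ GH].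
move=> /eq_block_mx[_ JQ _ JU] /eq_block_mx[_ DQ _ DU].
apply: (@similar_of_intertwining _ _ (eps1^-1 * eps2) (eps1^-1 * eps3)
  A B C D (starmx conj A) (starmx conj B) Q U) GH => //.
- by rewrite mulf_neq0 ?invr_eq0.
- by rewrite -scalerA scalemxAl JQ.
- by rewrite -scalerA scalemxAl DQ.
Qed.

End StarCongruence.

(** * Evaluation of noncommutative polynomials *)

Section Evaluation.
Variables (F : fieldType) (conj : F -> F).

Lemma nceval_monomial n (A B : 'M[F]_n) (c : F) (w : {fmonom 'I_4}) :
  nceval conj A B << c *g w >> =
  c *: \prod_(l <- w) tnth [tuple A; B; starmx conj A; starmx conj B] l.
Proof.
rewrite /nceval msuppU; case: eqP => [->|_].
  by rewrite big_seq_fset0 scale0r.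
by rewrite big_seq_fset1 mcoeffUU.
Qed.

Lemma nceval_const n (A B : 'M[F]_n) (c : F) : nceval conj A B c%:MP = c%:M.
Proof. by rewrite nceval_monomial fm1 big_nil scalemx1. Qed.

Lemma nceval_letter n (A B : 'M[F]_n) (c : F) (l : 'I_4) :
  nceval conj A B << c *g fmu l >> =
  c *: tnth [tuple A; B; starmx conj A; starmx conj B] l.
Proof. by rewrite nceval_monomial fmU big_seq1. Qed.

Lemma nceval0 n (A B : 'M[F]_n) : nceval conj A B 0 = 0.
Proof. by rewrite -malgC0E nceval_const raddf0. Qed.

End Evaluation.

(** * The triple as a substitution *)

Lemma Rank_val m n (i : 'I_m) (j : 'I_n) :
  tagnat.Rank (p_ := fun=> n) i j = (i * n + j)%N :> nat.
Proof.
rewrite tagnat.RankEsum -(big_ord_widen m (fun=> n)) 1?ltnW //.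
by rewrite sum_nat_const card_ord.
Qed.

Lemma mxblock_Rank (T : Type) m n (B : 'I_m -> 'I_m -> 'M[T]_n) i j k l :
  (\mxblock_(i, j) B i j) (tagnat.Rank i k) (tagnat.Rank j l) = B i j k l.
Proof. by have /matrixP/(_ k l) := mxblockK B i j; rewrite mxE. Qed.

(** The two ways of laying out (m1 + m2) * n rows agree because the position of
    row j of block i is i * n + j in either of them; only the expressions for
    the size differ, whence the cast. *)
Lemma mxblock_split (T : Type) m1 m2 n
    (e : (\sum_(i < m1 + m2) n = \sum_(i < m1) n + \sum_(i < m2) n)%N)
    (B : 'I_(m1 + m2) -> 'I_(m1 + m2) -> 'M[T]_n) :
  castmx (e, e) (\mxblock_(i, j) B i j) =
  block_mx (\mxblock_(i, j) B (lshift m2 i) (lshift m2 j))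
           (\mxblock_(i, j) B (lshift m2 i) (rshift m1 j))
           (\mxblock_(i, j) B (rshift m1 i) (lshift m2 j))
           (\mxblock_(i, j) B (rshift m1 i) (rshift m1 j)).
Proof.
have lE (s : 'I_(\sum_(i < m1) n)) : cast_ord (esym e) (lshift _ s) =
    tagnat.Rank (p_ := fun=> n) (lshift m2 (tagnat.sig1 s)) (tagnat.sig2 s).
  apply: val_inj; rewrite [RHS]Rank_val /=.
  by rewrite -[in LHS](tagnat.sig2K s) Rank_val.
have rE (s : 'I_(\sum_(i < m2) n)) : cast_ord (esym e) (rshift _ s) =
    tagnat.Rank (p_ := fun=> n) (rshift m1 (tagnat.sig1 s)) (tagnat.sig2 s).
  apply: val_inj; rewrite [RHS]Rank_val /= -[in LHS](tagnat.sig2K s) Rank_val.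
  by rewrite sum_nat_const card_ord mulnDl addnA.
apply/matrixP=> x y; rewrite castmxE /=.
case: (split_ordP x) => i ->; case: (split_ordP y) => j ->;
  by rewrite ?block_mxEul ?block_mxEur ?block_mxEdl ?block_mxEdr
             ?lE ?rE mxblock_Rank mxE.
Qed.

Section PolynomialTriple.
Variable F : fieldType.

(** The scalar c enters both as the constant block and as the coefficient of the
    letters, so that c = eps3 at the starred letters gives the lower left
    quarter of the third matrix, factor included. *)
Definition polyD4 (c : F) (x y : 'I_4) : 'M[ncpoly F]_4 :=
  \matrix_(i, j)
    if i == j then [:: c%:MP; << c *g fmu x >>; << c *g fmu y >>; 0]`_i else 0.

Definition polyoff (a b : 'M[ncpoly F]_4) : 'M[ncpoly F]_(4 + 4) :=
  block_mx 0 a b 0.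

Definition polyTeps (eps1 eps2 eps3 : F) : 3.-tuple 'M[ncpoly F]_(4 + 4) :=
  let C (M : 'M[F]_4) : 'M[ncpoly F]_4 := map_mx (@malgC _ F) M in
  let J : 'M[F]_4 := \matrix_(i, j) (j == i.+1 :> nat)%:R in
  [tuple polyoff (C 1%:M) (C eps1%:M); polyoff (C J) (C (eps2 *: J^T));
         polyoff (polyD4 1 0 1) (polyD4 eps3 2 3)].

Lemma ncsubst_polyoff conj n
    (e : (\sum_(i < 4 + 4) n = \sum_(i < 4) n + \sum_(i < 4) n)%N)
    (A B : 'M[F]_n) (a b : 'M[ncpoly F]_4) :
  castmx (e, e) (ncsubst conj A B (polyoff a b)) =
  block_mx 0 (ncsubst conj A B a) (ncsubst conj A B b) 0.
Proof.
rewrite {1}/ncsubst mxblock_split; congr block_mx; apply: blkP => i j;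
  rewrite !blk_mxblock ?block_mxEul ?block_mxEur ?block_mxEdl ?block_mxEdr //.
- by rewrite mxE nceval0 [RHS]submxblock0.
- by rewrite mxE nceval0 [RHS]submxblock0.
Qed.

Lemma ncsubst_const conj n (A B : 'M[F]_n) (M : 'M[F]_4) i j :
  blk (ncsubst conj A B (map_mx (@malgC _ F) M)) i j = (M i j)%:M.
Proof. by rewrite blk_mxblock mxE nceval_const. Qed.

Lemma ncsubst_polyD4 conj n (A B : 'M[F]_n) (c : F) (x y : 'I_4) :
  let letter := tnth [tuple A; B; starmx conj A; starmx conj B] in
  ncsubst conj A B (polyD4 c x y) = c *: D4 (letter x) (letter y).
Proof.
move=> letter; apply: blkP => i j; rewrite blkZ blk_diag blk_mxblock mxE.
case: eqP => _; last by rewrite nceval0 scaler0.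
case: i => [[|[|[|[|//]]]] ?] /=.
- by rewrite nceval_const scalemx1.
- by rewrite nceval_letter.
- by rewrite nceval_letter.
- by rewrite nceval0 scaler0.
Qed.

Lemma ncsubst_polyTeps conj eps1 eps2 eps3 n
    (e : (\sum_(i < 4 + 4) n = \sum_(i < 4) n + \sum_(i < 4) n)%N)
    (A B : 'M[F]_n) :
  map_tuple (castmx (e, e))
    (map_tuple (ncsubst conj A B) (polyTeps eps1 eps2 eps3)) =
  Teps conj eps1 eps2 eps3 A B.
Proof.
rewrite /polyTeps 2!map_tuple3.
apply: tuple3_eq; rewrite ncsubst_polyoff; congr block_mx.
- apply: blkP => i j; rewrite ncsubst_const blk1 mxE.
  by case: eqP => _; rewrite ?raddf0.
- apply: blkP => i j; rewrite ncsubst_const blkZ blk1 mxE.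
  by case: eqP => _; rewrite ?scalemx1 // mulr0n raddf0 scaler0.
- apply: blkP => i j; rewrite ncsubst_const blk_J4 mxE.
  by case: eqP => _; rewrite ?raddf0.
- apply: blkP => i j; rewrite ncsubst_const blkZ blk_tr blk_J4 !mxE.
  case: eqP => _; first by rewrite mulr1 trmx1 scalemx1.
  by rewrite mulr0 trmx0 raddf0 scaler0.
- by rewrite ncsubst_polyD4 scale1r.
- by rewrite ncsubst_polyD4.
Qed.

End PolynomialTriple.

(** * Wildness *)

(** Lets the sizes 8n and 4n + 4n, equal but not convertible, be exchanged. *)
Lemma cast_triple (T : Type) (class : forall n, 3.-tuple 'M[T]_n -> Prop)
    (equiv : forall n, 3.-tuple 'M[T]_n -> 3.-tuple 'M[T]_n -> Prop)
    m n (e : m = n) (A B : 3.-tuple 'M[T]_m) :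
  (class n (map_tuple (castmx (e, e)) A) <-> class m A) /\
  (equiv n (map_tuple (castmx (e, e)) A) (map_tuple (castmx (e, e)) B) <->
   equiv m A B).
Proof.
case: n / e; have id (C : 3.-tuple 'M[T]_m) :
    map_tuple (castmx (erefl, erefl)) C = C.
  by apply: eq_from_tnth => i; rewrite tnth_map castmx_id.
by rewrite !id.
Qed.

(** One triple serves all the classification problems: only membership in the
    class depends on the signs and on the involution. *)
Lemma wild_Teps (F : fieldType) (conj : involutive_rmorphism F)
    (eps1 eps2 eps3 : F) (class : forall n, 3.-tuple 'M[F]_n -> Prop) :
  eps1 != 0 -> eps2 != 0 ->
  (forall n (A B : 'M[F]_n), class _ (Teps conj eps1 eps2 eps3 A B)) ->
  wild_triples conj class (fun n => @star_congruent F conj 3 n).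
Proof.
move=> e1 e2 classT; exists (4 + 4)%N, (polyTeps eps1 eps2 eps3) => n _ TT.
have e : (\sum_(i < 4 + 4) n = \sum_(i < 4) n + \sum_(i < 4) n)%N.
  exact: big_split_ord.
have cast A B C D := cast_triple class
  (fun n => @star_congruent F conj 3 n) e (TT A B) (TT C D).
split=> [A B | A B C D].
  by apply/(cast A B A B).1; rewrite ncsubst_polyTeps.
split=> [AB|]; first apply/(cast A B C D).2.
  by rewrite !ncsubst_polyTeps; apply: Teps_star_congruent.
move=> /(cast A B C D).2; rewrite !ncsubst_polyTeps.
exact: similar_of_star_congruent.
Qed.

(** With eps_i = 1 this makes the i-th matrix Hermitian; with the identity
    involution and eps_i = -1 it makes it skew-symmetric. *)
Lemma starmx_Teps (F : fieldType) (conj : involutive_rmorphism F)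
    (eps1 eps2 eps3 : F) n (A B : 'M[F]_n) (i : 'I_3) :
  let eps := tnth [tuple eps1; eps2; eps3] i in
  conj eps * eps = 1 ->
  starmx conj (tnth (Teps conj eps1 eps2 eps3 A B) i) =
  conj eps *: tnth (Teps conj eps1 eps2 eps3 A B) i.
Proof.
rewrite TepsE; move: i; apply: ord3_ind; rewrite !tnth3; exact: starmx_offdiag.
Qed.

Theorem theorem1 (F : closedFieldType) (charF : 2%N \notin [pchar F]) :
  (* (a) *)
  (forall (conj : involutive_rmorphism F) (eps1 eps2 eps3 : F),
     eps1 != 0 -> eps2 != 0 ->
     forall (n : nat) (A B C D : 'M[F]_n),
       similar_pairs A B C D <->
       star_congruent conj (Teps conj eps1 eps2 eps3 A B)
                           (Teps conj eps1 eps2 eps3 C D)) /\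
  (* (b)(i) *)
  (forall conj : involutive_rmorphism F,
     (exists a : F, conj a <> a) ->
     wild_triples conj (fun n => @hermitian_triple F conj n)
                       (fun n => @star_congruent F conj 3 n)) /\
  (* (b)(ii) *)
  (forall eps1 eps2 eps3 : F,
     eps1 \in [:: 1; -1] -> eps2 \in [:: 1; -1] -> eps3 \in [:: 1; -1] ->
     wild_triples idfun
       (fun n => @signed_symmetric_triple F [tuple eps1; eps2; eps3] n)
       (fun n => @star_congruent F idfun 3 n)).
Proof.
split.
  move=> conj eps1 eps2 eps3 e1 e2 n A B C D.
  by split; [apply: Teps_star_congruent | apply: similar_of_star_congruent].
split.
  move=> conj _; apply: (@wild_Teps _ _ 1 1 1); rewrite ?oner_eq0 //.
  move=> n A B i; have := @starmx_Teps _ conj 1 1 1 n A B i.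
  have -> : tnth [tuple 1; 1; 1] i = 1 :> F.
    by move: i; apply: ord3_ind; rewrite tnth3.
  by rewrite /= rmorph1 mulr1 scale1r; apply.
move=> eps1 eps2 eps3 e1 e2 e3.
have sign_neq0 (x : F) : x \in [:: 1; -1] -> x != 0.
  by rewrite !inE => /orP[]/eqP->; rewrite ?oppr_eq0 oner_eq0.
apply: (@wild_Teps _ idfun eps1 eps2 eps3); rewrite ?sign_neq0 //.
move=> n A B i; have := @starmx_Teps _ idfun eps1 eps2 eps3 n A B i.
move: (tnth (Teps _ _ _ _ _ _) i) => X /= starX.
split=> epsi; move: starX; rewrite epsi ?mulrNN mulr1 => /(_ erefl) starX.
  apply/is_hermitianmxP.
  by rewrite expr0 scale1r -[RHS]/(starmx idfun X) starX scale1r.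
apply/is_hermitianmxP.
rewrite expr1 -[map_mx _ _]/(starmx idfun X) starX.
by rewrite scalerA mulrNN mulr1 scale1r.
Qed.
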